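(* Let $n\ge 1$. There is a bijection $\phi:\mathcal{T}_n\to \mathcal{RS}_n$ such that every tree $T\in\mathcal{T}_n$ with $k+1$ leaves is mapped to a permutation $\phi(T)\in\mathcal{RS}_n$ with exactly $k$ descents.
   Context: For $\sigma=\sigma_1\cdots\sigma_n\in\mathfrak{S}_n$, a descent is an index $i$ ($1\le i\le n-1$) with $\sigma_i>\sigma_{i+1}$, and a double descent is an index $i$ ($1\le i\le n-2$) with $\sigma_i>\sigma_{i+1}>\sigma_{i+2}$. The permutation $\sigma$ is simsun if for every $k$, the subword of $\sigma$ consisting of the letters in $\{1,\dots,k\}$ (in the order they appear in $\sigma$) has no double descent. $\mathcal{RS}_n$ denotes the set of simsun permutations in $\mathfrak{S}_n$. A rooted tree on vertex set $\{0,1,\dots,n\}$ with root $0$ is increasing if every path starting at the root has increasing labels. $\mathcal{T}_n$ is the set of increasing trees on $\{0,1,\dots,n\}$ rooted at $0$ in which every vertex has at most two children, where the order of the children (subtrees) of a vertex is irrelevant (increasing 1-2 trees). A leaf is a vertex with no children. *)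

(* Defs.v *)
From mathcomp Require Import all_boot all_fingroup.

Set Implicit Arguments.
Unset Strict Implicit.
Unset Printing Implicit Defensive.

(* Simple graphs are given by their edge sets.  Paths and cycles are simple    *)
(* (no repeated vertex) and [p : n.-bseq V] ranges over sequences of size at   *)
(* most [n], so the bounded quantifiers below lose no path or cycle on the     *)
(* [n.+1] vertices 0, ..., n.                                                  *)

Section Trees.
Variable n : nat.
Notation V := 'I_n.+1.
Implicit Types (E : {set {set V}}) (x y : V).

Definition adj E : rel V := fun x y => [set x; y] \in E.

Definition simple_graph E := [forall e in E, #|e| == 2].

Definition connected E := [forall x, [forall y, connect (adj E) x y]].

(* In a simple graph the only nonempty [ucycle]s of size less than 3 are the   *)
(* degenerate [:: x; y] with x and y adjacent, which are not graph cycles.     *)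
Definition acyclic E :=
  [forall c : n.+1.-bseq V, ucycleb (adj E) c ==> (size c < 3)].

Definition tree E := [&& simple_graph E, connected E & acyclic E].

(* [p] lists the vertices after the root 0. *)
Definition root_path E (p : seq V) :=
  path (adj E) ord0 p && uniq (ord0 :: p).

Definition increasing E :=
  [forall p : n.-bseq V,
     root_path E p ==> sorted ltn [seq val x | x <- ord0 :: p]].

(* [y] is a child of [x] when [x] precedes [y] on the path from 0 to [y]. *)
Definition child E x y :=
  [exists p : n.-bseq V,
     [exists q : n.-bseq V,
        [&& root_path E p, p == rcons q y :> seq V & last ord0 q == x]]].

Definition children E x : {set V} := [set y | child E x y].

Definition leaves E : {set V} := [set x | children E x == set0].

Definition increasing_12_trees : {set {set {set V}}} :=
  [set E | [&& tree E, increasing E & [forall x, #|children E x| <= 2]]].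

End Trees.

(* The one-line word of [s], in the letters 1, ..., n. *)
Definition word n (s : 'S_n) : seq nat := [seq (val (s i)).+1 | i <- enum 'I_n].

(* Positions are numbered from 0. *)
Definition descents (w : seq nat) : {set 'I_(size w).-1} :=
  [set i : 'I_(size w).-1 | nth 0 w i > nth 0 w i.+1].

Definition double_descents (w : seq nat) : {set 'I_(size w).-2} :=
  [set i : 'I_(size w).-2 |
     (nth 0 w i > nth 0 w i.+1) && (nth 0 w i.+1 > nth 0 w i.+2)].

Definition simsun_perms n : {set 'S_n} :=
  [set s : 'S_n |
     [forall k : 'I_n.+1, double_descents [seq a <- word s | a <= k] == set0]].

(* Main.v *)
(* Trees and simsun words grow by the same rule, so the number of leaves on    *)
(* trees and the number of descents plus one on words are equidistributed, and *)
(* it remains to match objects with equal statistics.                          *)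
(*                                                                             *)
(* In a tree with n.+1 vertices and l leaves, n.+2 - 2 l vertices have exactly *)
(* one child.  Hanging the next vertex on one of the l leaves keeps the number *)
(* of leaves; hanging it on a vertex with one child adds a leaf.               *)
(*                                                                             *)
(* In a simsun word of size n with l - 1 descents, inserting the next letter   *)
(* inside a descent or at the end (l slots) keeps the number of descents;      *)
(* inserting it elsewhere adds a descent, and it creates a double descent      *)
(* exactly when it is put in front of the first letter of a descent.  As there *)
(* is no double descent, this leaves n.+2 - 2 l slots.                         *)

Require Import Defs.
From mathcomp Require Import all_boot all_fingroup.
From mathcomp Require Import zify.

Set Implicit Arguments.
Unset Strict Implicit.
Unset Printing Implicit Defensive.

(** Two finite sets whose statistics have the same multiset of values admit a bijection preserving
    the statistic ([perm_stat_bij]). So no explicit map is built: [perm_leaves_descents] compares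
    the multisets by induction on n. On both sides each object of size n+1 extends exactly one
    object of size n, and the extensions of an object with statistic l have the statistics
    [extension_stats n l] ([simsun_words_stats], [parent_seqs_stats]). Simsun words are extended by
    inserting n+1, which is undone by deleting the largest letter ([perm_simsun_wordsS]). An
    increasing tree amounts to the sequence of parents of 1, ..., n, each smaller than its child
    ([increasing_tree_graph_of], [graph_of_tree], [graph_of_increasing], [graph_of_inj]). Its leaves
    are the labels absent from the sequence, and the 1-2 condition says that no label occurs more
    than twice. *)

(** * Multisets of statistics *)

Lemma uniq_flatten_map (T U : eqType) (g : U -> T) (t : T -> seq U) s :
    uniq s -> {in s, forall w, uniq (t w)} ->
    {in s, forall w, {in t w, forall u, g u = w}} ->
  uniq (flatten (map t s)).
Proof.
elim: s => //= w s IHs /andP[w_s uniq_s] uniq_t gK.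
rewrite cat_uniq uniq_t ?mem_head //= IHs //; first last.
- by move=> v v_s; apply: gK; rewrite inE v_s orbT.
- by move=> v v_s; apply: uniq_t; rewrite inE v_s orbT.
rewrite andbT; apply/hasPn => u /flatten_mapP[v v_s u_v].
apply: contra w_s => /(gK w (mem_head _ _)) <-.
by rewrite (gK v) // inE v_s orbT.
Qed.

(** This makes the recursion descend to statistics: if those of the extensions of [x] depend on
    [a x] only, one generation's multiset determines the next. *)
Lemma perm_map_flatten (T R : eqType) (a : T -> R) (a' : T -> R) (t : T -> seq T)
    (c : R -> seq R) s :
    {in s, forall x, perm_eq (map a' (t x)) (c (a x))} ->
  perm_eq (map a' (flatten (map t s))) (flatten (map c (map a s))).
Proof.
elim: s => //= x s IHs tP; rewrite map_cat perm_cat ?tP ?mem_head ?IHs //.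
by move=> y y_s; apply: tP; rewrite inE y_s orbT.
Qed.

Lemma perm_flatten_map (T R : eqType) (c : T -> seq R) s1 s2 :
  perm_eq s1 s2 -> perm_eq (flatten (map c s1)) (flatten (map c s2)).
Proof.
move=> s12; apply/seq.permP => P; rewrite !count_flatten.
by apply: perm_sumn; rewrite !perm_map.
Qed.

(** A permutation of positions aligns the two lists of values; conjugated by the enumerations of [A]
    and [B], it is the bijection. *)
Lemma perm_stat_bij (A B : finType) (a : A -> nat) (b : B -> nat) :
    perm_eq (map a (enum A)) (map b (enum B)) ->
  exists phi : A -> B, bijective phi /\ forall x, b (phi x) = a x.
Proof.
move=> ab; have sAB : #|A| = #|B|.
  by move/perm_size: ab; rewrite !size_map -!enumT -!cardE.
have szb : size (map b (enum B)) == #|A| by rewrite size_map sAB cardE enumT.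
have [p Ep] := @tuple_permP _ _ (map a (enum A)) (Tuple szb) ab.
exists (fun x => enum_val (cast_ord sAB (p (enum_rank x)))); split.
  apply: (bij_comp (f := enum_val)); first exact: enum_val_bij.
  apply: (bij_comp (f := cast_ord sAB)).
    by exists (cast_ord (esym sAB)); [apply: cast_ordK | apply: cast_ordKV].
  apply: bij_comp; last exact: enum_rank_bij.
  by exists (p^-1)%g; [apply: permK | apply: permKV].
move=> x; have /(congr1 (nth 0 ^~ (enum_rank x))) := Ep.
rewrite (nth_map x) -?cardE // nth_enum_rank => ->.
rewrite -tnth_nth tnth_mktuple /= (tnth_nth 0) /=.
(* [y0] only serves as the default element for [nth]. *)
set i := p _; have y0 := enum_val (cast_ord sAB i).
rewrite (nth_map y0) -?enumT -?cardE -?sAB //.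
by rewrite (enum_val_nth y0).
Qed.

(** Statistics of all extensions of one object of size [n] and statistic [l]: [l] slots keep the
    statistic, the others raise it by one. *)
Definition extension_stats n l := nseq l l ++ nseq (n.+2 - l.*2) l.+1.

(** * Simsun words *)

Definition starts_down (w : seq nat) := if w is x :: y :: _ then y < x else false.

Fixpoint des w := if w is _ :: w' then starts_down w + des w' else 0.

Fixpoint dd_free w :=
  if w is _ :: w' then ~~ (starts_down w && starts_down w') && dd_free w' else true.

Fixpoint insertions (m : nat) (w : seq nat) :=
  (m :: w) :: (if w is x :: w' then map (cons x) (insertions m w') else [::]).

Lemma insertions_perm m w u : u \in insertions m w -> perm_eq u (m :: w).
Proof.
elim: w u => [|x w IHw] u /=; first by rewrite inE => /eqP->.
rewrite inE => /predU1P[-> //|].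
case/mapP=> v /IHw v_mw ->.
apply: (@perm_trans _ (x :: m :: w)); first by rewrite perm_cons.
by apply/permPl; apply: (perm_catCA [:: x] [:: m]).
Qed.

Lemma insertionsK m w u :
  all (ltn^~ m) w -> u \in insertions m w -> [seq a <- u | a < m] = w.
Proof.
elim: w u => [|x w IHw] u /=.
  by rewrite inE => _ /eqP-> /=; rewrite ltnn.
case/andP=> x_m w_m; rewrite inE => /predU1P[->|/mapP[v v_w ->]] /=.
  by rewrite ltnn x_m (all_filterP w_m).
by rewrite x_m IHw.
Qed.

Lemma mem_insertions m u :
    all (fun a => a <= m) u -> count_mem m u = 1 ->
  u \in insertions m [seq a <- u | a < m].
Proof.
elim: u => //= x u IHu /andP[x_m u_m].
have [->|neq_xm] := eqVneq x m.
  rewrite ltnn add1n => -[u0]; rewrite (all_filterP _); first by case: (u) => *; apply: mem_head.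
  apply/allP=> a au; rewrite ltn_neqAle (allP u_m) // andbT.
  by apply: contraTneq au => ->; rewrite -has_pred1 has_count u0.
move=> u1; rewrite ltn_neqAle neq_xm x_m /= inE mem_map ?IHu ?orbT //.
by move=> ? ? [].
Qed.

Lemma insertions_uniq m w : all (ltn^~ m) w -> uniq (insertions m w).
Proof.
elim: w => //= x w IHw /andP[x_m w_m].
rewrite map_inj_uniq ?IHw ?andbT //; last by move=> ? ? [].
by apply/mapP => -[v _ [/eqP]]; rewrite gtn_eqF.
Qed.

Lemma des_cons x w : des (x :: w) = starts_down (x :: w) + des w.
Proof. by []. Qed.

Lemma dd_free_cons x w :
  dd_free (x :: w) = ~~ (starts_down (x :: w) && starts_down w) && dd_free w.
Proof. by []. Qed.

Lemma starts_down_max m w : all (ltn^~ m) w -> starts_down (m :: w) = (w != [::]).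
Proof. by case: w => //= x w /andP[-> _]. Qed.

Lemma starts_down_cons_max x m w : x < m -> starts_down [:: x, m & w] = false.
Proof. by move=> x_m /=; rewrite ltnNge ltnW. Qed.

(* The letter [m] goes anywhere but in front of the word [x :: w]. *)
Lemma count_insertions_tail m x w (P : pred nat) :
    all (ltn^~ m) (x :: w) -> dd_free (x :: w) ->
  exists2 r, count (fun u => dd_free (x :: u) && P (des (x :: u))) (insertions m w) =
               (des (x :: w)).+1 * P (des (x :: w)) + r * P (des (x :: w)).+1
           & r + (des (x :: w)).*2 = size w + starts_down (x :: w).
Proof.
elim: w x P => [|y w IHw] x P.
  move=> /andP[x_m _] _; exists 0 => //=.
  by rewrite ltnNge ltnW //= !addn0 mul1n.
move=> xyw_m; have [x_m yw_m] : x < m /\ all (ltn^~ m) (y :: w) by apply/andP.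
rewrite dd_free_cons => /andP[sd_xy dd_free_yw].
pose b : bool := y < x.
have sd_xyE u : starts_down [:: x, y & u] = b by [].
(* The predicate is shifted by [b], the contribution of the pair x, y, which no insertion behind y
   affects. *)
have [r cr Er] := IHw y (fun d => P (b + d)) yw_m dd_free_yw.
have -> : insertions m (y :: w) = (m :: y :: w) :: map (cons y) (insertions m w).
  by [].
have count_cons T (Q : pred T) a u : count Q (a :: u) = Q a + count Q u by [].
have y_m : y < m by case/andP: yw_m.
rewrite count_cons count_map.
(* Inserting behind y creates no double descent at x: y is followed either by its former successor
   or by the larger [m]. *)
rewrite (eq_in_count (a2 := fun u => dd_free (y :: u) && P (b + des (y :: u)))); last first.
  move=> u u_w; rewrite /preim /= -/(starts_down (y :: u)) -[y < x]/b.
  suff -> : b && starts_down (y :: u) = false by [].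
  move: sd_xy; rewrite sd_xyE; case: (b) => //= /negbTE.
  case: (w) u_w => [|z w'] /=.
    by rewrite inE => /eqP-> _ /=; rewrite ltnNge ltnW.
  rewrite inE => /predU1P[-> _ /=|/mapP[v _ ->]//].
  by rewrite ltnNge ltnW.
rewrite {}cr (des_cons x (y :: w)) sd_xyE.
rewrite (dd_free_cons x) (dd_free_cons m) (des_cons x) (des_cons m).
rewrite (starts_down_cons_max _ x_m) (starts_down_max yw_m) dd_free_yw.
rewrite andTb add0n andbT.
have -> : size (y :: w) = (size w).+1 by [].
move: sd_xy Er; rewrite sd_xyE; set e := starts_down _; set d := des _.
case: (b) => /=; rewrite ?add0n ?add1n.
  (* If x > y, no descent starts at y, and [m] between them replaces the descent x y by m y: this
     slot keeps the count. *)
  move=> /negbTE-> Er; exists r; last by lia.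
  nia.
(* If x < y, [m] between them adds a descent, admissible exactly when none starts at y. *)
move=> _ Er; exists (r + ~~ e); last by case: (e) Er => /=; lia.
case: (e) => /=; nia.
Qed.

Lemma insertions_stats m w :
    all (ltn^~ m) w -> dd_free w ->
  perm_eq [seq (des u).+1 | u <- insertions m w & dd_free u]
          (extension_stats (size w) (des w).+1).
Proof.
move=> w_m dd_free_w; apply/seq.permP => P.
rewrite count_map count_filter /extension_stats count_cat !count_nseq.
case: w w_m dd_free_w => [|x w] w_m dd_free_w.
  by rewrite /= andbT subnn muln0 muln1.
have [r cr Er] := count_insertions_tail (P \o succn) w_m dd_free_w.
have -> : insertions m (x :: w) = (m :: x :: w) :: map (cons x) (insertions m w).
  by [].
have count_cons T (Q : pred T) a u : count Q (a :: u) = Q a + count Q u by [].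
rewrite (eq_count (a2 := fun u => dd_free u && P (des u).+1)); last first.
  by move=> u; apply: andbC.
rewrite count_cons count_map [count _ _]cr.
rewrite (dd_free_cons m) (des_cons m) (starts_down_max w_m) dd_free_w.
have -> : size (x :: w) = (size w).+1 by [].
move: Er; rewrite andbT andTb.
set e := starts_down _; set d := des _ => Er.
(* The remaining slot, in front of the word, adds a descent and is admissible exactly when the word
   does not start with one. *)
have -> : (size w).+3 - d.+1.*2 = r + ~~ e by move: Er; case: (e) => /=; lia.
by case: (e) => /=; rewrite ?add1n; nia.
Qed.

Lemma card_descents w : #|descents w| = des w.
Proof.
rewrite /descents -sum1dep_card big_mkcond /=.
elim: w => [|x [|y w] IHw]; first by rewrite big_ord0.
  by rewrite big_ord0.
rewrite des_cons -IHw big_ord_recl /=; congr (_ + _); case: (y < x).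
Qed.

Lemma double_descents_eq0 w : (double_descents w == set0) = dd_free w.
Proof.
have -> : (double_descents w == set0) =
    [forall i : 'I_(size w).-2, ~~ (nth 0 w i.+2 < nth 0 w i.+1 < nth 0 w i)].
  apply/eqP/forallP => [dd0 i|ndd].
    by apply/negP => /andP[? ?]; have /setP/(_ i) := dd0; rewrite !inE; lia.
  by apply/setP=> i; rewrite !inE andbC; apply/negbTE/ndd.
elim: w => [|x [|y [|z w]] IHw];
  try by rewrite /= ?andbF; apply/forallP => -[].
rewrite dd_free_cons -IHw /=; apply/forallP/andP => [ndd|[nxyz /forallP nyz] i].
  split; first by rewrite andbC; have := ndd ord0.
  by apply/forallP=> i; apply: ndd (lift ord0 i).
case: (unliftP ord0 i) => [j ->|->]; last by rewrite /= andbC.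
exact: nyz j.
Qed.

(** * Generation of simsun words by insertion *)

Definition simsun n w := all (fun k => dd_free [seq a <- w | a <= k]) (iota 0 n.+1).

Definition simsun_words n := [seq w <- permutations (iota 1 n) | simsun n w].

Lemma simsun_words_uniq n : uniq (simsun_words n).
Proof. exact/filter_uniq/permutations_uniq. Qed.

Lemma mem_simsun_words n w :
  (w \in simsun_words n) = simsun n w && perm_eq w (iota 1 n).
Proof. by rewrite mem_filter mem_permutations. Qed.

Lemma filter_leq_id n w : all (fun a => a <= n) w -> [seq a <- w | a <= n] = w.
Proof. exact: all_filterP. Qed.

Lemma all_leq_perm_iota n w : perm_eq w (iota 1 n) -> all (fun a => a <= n) w.
Proof. by move/perm_all->; apply/allP=> a; rewrite mem_iota; lia. Qed.

Lemma simsun_dd_free n w : perm_eq w (iota 1 n) -> simsun n w -> dd_free w.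
Proof.
move=> /all_leq_perm_iota w_n /allP/(_ n); rewrite filter_leq_id //.
by apply; rewrite mem_iota; lia.
Qed.

(** The restrictions to k <= n only see the word without n+1; for k = n+1 the restriction is the
    whole word. *)
Lemma simsunS n w : all (fun a => a <= n.+1) w ->
  simsun n.+1 w = simsun n [seq a <- w | a <= n] && dd_free w.
Proof.
move=> w_n; rewrite /simsun -addn1 iotaD all_cat all_seq1 add0n filter_leq_id //.
congr (_ && _); apply: eq_in_all => k; rewrite mem_iota => k_n.
by rewrite -filter_predI; congr dd_free; apply: eq_filter => a /=; lia.
Qed.

Lemma perm_simsun_wordsS n :
  perm_eq (simsun_words n.+1)
    (flatten [seq [seq u <- insertions n.+1 w | dd_free u] | w <- simsun_words n]).
Proof.
have lt_n w : w \in simsun_words n -> all (ltn^~ n.+1) w.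
  by rewrite mem_simsun_words => /andP[_ /all_leq_perm_iota].
apply: uniq_perm; first exact: simsun_words_uniq.
  apply: (@uniq_flatten_map _ _ (filter (ltn^~ n.+1))) => [|w w_n|w w_n u].
  - exact: simsun_words_uniq.
  - by apply/filter_uniq/insertions_uniq/lt_n.
  - by rewrite mem_filter => /andP[_]; apply/insertionsK/lt_n.
have iotaS : iota 1 n.+1 = iota 1 n ++ [:: n.+1] by rewrite -[in LHS](addn1 n) iotaD add1n.
move=> u; apply/idP/flatten_mapP => [|[w w_n]].
  rewrite mem_simsun_words => /andP[simsun_u u_n].
  have u_le := all_leq_perm_iota u_n.
  move: simsun_u; rewrite simsunS // => /andP[simsun_w dd_free_u].
  exists [seq a <- u | a <= n].
    rewrite mem_simsun_words simsun_w /=.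
    apply: perm_trans (perm_filter (leq^~ n) u_n) _.
    rewrite iotaS filter_cat /= ltnn cats0 filter_leq_id //.
    exact: all_leq_perm_iota.
  rewrite mem_filter dd_free_u; apply: mem_insertions => //.
  rewrite (seq.permP u_n) count_uniq_mem ?iota_uniq // mem_iota; lia.
rewrite mem_filter => /andP[dd_free_u u_w].
have /perm_trans-/(_ (iota 1 n.+1)) u_n := insertions_perm u_w.
move: (w_n); rewrite !mem_simsun_words => /andP[simsun_w wn].
have {}u_n : perm_eq u (iota 1 n.+1).
  by apply: u_n; rewrite iotaS perm_sym perm_catC /= perm_cons perm_sym.
rewrite simsunS ?all_leq_perm_iota // dd_free_u u_n !andbT.
by rewrite (insertionsK (lt_n _ w_n) u_w).
Qed.

Lemma simsun_words_stats n :
  perm_eq [seq (des w).+1 | w <- simsun_words n.+1]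
    (flatten [seq extension_stats n l | l <- [seq (des w).+1 | w <- simsun_words n]]).
Proof.
apply: perm_trans (perm_map _ (perm_simsun_wordsS n)) _.
apply: perm_map_flatten => w; rewrite mem_simsun_words => /andP[simsun_w w_n].
rewrite -{2}(size_iota 1 n) -(perm_size w_n); apply: insertions_stats.
  exact: (all_leq_perm_iota w_n).
exact: simsun_dd_free simsun_w.
Qed.

(** * Permutations and their one-line words *)

Lemma word_inj n : injective (@word n).
Proof.
move=> s t /eq_in_map st; apply/permP => i.
by have := st i (mem_enum _ i) => -[/val_inj].
Qed.

Lemma perm_word n (s : 'S_n) : perm_eq (word s) (iota 1 n).
Proof.
have -> : word s = map succn (map val (map s (enum 'I_n))) by rewrite -2!map_comp.
rewrite (iotaDl 1 0 n) -val_enum_ord; do 2!apply: perm_map.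
apply: uniq_perm; rewrite ?(map_inj_uniq (@perm_inj _ s)) ?enum_uniq // => i.
by rewrite mem_enum -[i](permKV s) map_f // mem_enum.
Qed.

Lemma perm_simsun_perms n :
  perm_eq [seq word s | s <- enum (simsun_perms n)] (simsun_words n).
Proof.
have perm_words : perm_eq [seq word s | s : 'S_n] (permutations (iota 1 n)).
  have uniq_words : uniq [seq word s | s : 'S_n].
    by rewrite map_inj_uniq ?enum_uniq //; apply: word_inj.
  have sub_words : {subset [seq word s | s : 'S_n] <= permutations (iota 1 n)}.
    by move=> _ /mapP[s _ ->]; rewrite mem_permutations perm_word.
  apply: uniq_perm => //; first exact: permutations_uniq.
  (* Both lists have n! entries, so the inclusion is an equality. *)
  have [] // := uniq_min_size uniq_words sub_words _.
  by rewrite size_map -cardE card_Sn size_permutations ?iota_uniq // size_iota.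
apply: perm_trans (perm_filter _ perm_words).
rewrite filter_map; apply: perm_map; apply: uniq_perm.
- exact: enum_uniq.
- exact/filter_uniq/enum_uniq.
move=> s; rewrite mem_enum inE mem_filter mem_enum andbT /=.
apply/forallP/allP => [simsun_s k|simsun_s k].
  rewrite mem_iota add0n => k_n.
  by have := simsun_s (Ordinal k_n); rewrite double_descents_eq0.
by rewrite double_descents_eq0; apply: simsun_s; rewrite mem_iota add0n ltn_ord.
Qed.

(** * Parent sequences *)

(** Entry [i] is the parent of vertex [i.+1]; the new vertex may hang on any earlier vertex with
    fewer than two children. *)
Fixpoint parent_seqs n :=
  if n is m.+1 then
    flatten [seq [seq rcons s v | v <- [seq v <- iota 0 m.+1 | count_mem v s < 2]]
            | s <- parent_seqs m]
  else [:: [::]].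

Lemma parent_seqsS n : parent_seqs n.+1 =
  flatten [seq [seq rcons s v | v <- [seq v <- iota 0 n.+1 | count_mem v s < 2]]
          | s <- parent_seqs n].
Proof. by []. Qed.

Lemma parent_seqsP n s :
  reflect [/\ size s = n, forall i, i < n -> nth 0 s i <= i
            & forall v, count_mem v s <= 2]
          (s \in parent_seqs n).
Proof.
elim: n s => [|n IHn] s.
  by rewrite inE; apply: (iffP eqP) => [->|[/size0nil]].
rewrite parent_seqsS.
apply: (iffP flatten_mapP) => [[t /IHn[sz_t t_le t_2]]|[]].
  case/mapP => v; rewrite mem_filter mem_iota => /andP[v_t v_n] ->.
  split=> [|i i_n|x]; first by rewrite size_rcons sz_t.
    by rewrite nth_rcons sz_t; case: ltngtP => [/t_le|//|->].
  rewrite -cats1 count_cat /= addn0; have [<-|_] := eqVneq v x; last by rewrite addn0.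
  by rewrite addn1.
case/lastP: s => [//|t v]; rewrite size_rcons => -[sz_t] t_le t_2.
exists t.
  apply/IHn; split=> // [i i_n|x].
    by have := t_le i (ltnW i_n); rewrite nth_rcons sz_t i_n.
  by apply: leq_trans (t_2 x); rewrite -cats1 count_cat leq_addr.
apply: map_f; rewrite mem_filter mem_iota.
have := t_le n (leqnn _); rewrite nth_rcons sz_t ltnn eqxx => v_n.
have := t_2 v; rewrite -cats1 count_cat /= eqxx; lia.
Qed.

Lemma parent_seqs_uniq n : uniq (parent_seqs n).
Proof.
elim: n => // n IHn; rewrite parent_seqsS; apply: (@uniq_flatten_map _ _ (take n)) => //.
  move=> s _; rewrite map_inj_uniq; last exact: rcons_injr.
  exact/filter_uniq/(iota_uniq 0 n.+1).
move=> s /parent_seqsP[sz_s _ _] _ /mapP[v _ ->].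
by rewrite -cats1 -{1}sz_s take_size_cat.
Qed.

Definition leaf_count n (s : seq nat) := count (fun v => v \notin s) (iota 0 n.+1).

(** The new vertex n+1 is a leaf, while [v] ceases to be one if it had no child. *)
Lemma leaf_count_rcons n s v :
    all (fun a => a <= n) s -> v <= n ->
  leaf_count n.+1 (rcons s v) = leaf_count n s + (v \in s).
Proof.
move=> s_n v_n; rewrite /leaf_count -[n.+2]addn1 iotaD count_cat add0n [count _ (iota n.+1 1)]/=.
have -> : n.+1 \notin rcons s v.
  rewrite mem_rcons inE negb_or gtn_eqF //=.
  by apply/negP => /(allP s_n); rewrite ltnn.
(* The old leaves split into those that survive and [v] itself, if it was a leaf. *)
have := count_predUI (fun w => w \notin rcons s v)
                     (fun w => (w == v) && (v \notin s)) (iota 0 n.+1).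
rewrite [in X in _ + X](eq_count (a2 := pred0)); last first.
  by move=> w /=; rewrite mem_rcons inE; case: (w == v); rewrite ?andbF.
rewrite (eq_count (a2 := fun w => w \notin s)); last first.
  move=> w /=; rewrite mem_rcons inE negb_or.
  by have [->|_] := eqVneq w v; rewrite ?orbF.
rewrite count_pred0 !addn0 => ->; rewrite -addnA; congr (_ + _).
case: (boolP (v \in s)) => v_s.
  rewrite (eq_count (a2 := pred0)) ?count_pred0 ?addn0 //.
  by move=> w; rewrite andbF.
rewrite (eq_count (a2 := pred1 v)) => [|w]; last by rewrite andbT.
by rewrite count_uniq_mem ?(iota_uniq 0 n.+1) // (mem_iota 0 n.+1) /= ltnS v_n addn0.
Qed.

Lemma sum_count_mem (r s : seq nat) :
  uniq r -> {subset s <= r} -> \sum_(v <- r) count_mem v s = size s.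
Proof.
move=> uniq_r; elim: s => [|x s IHs] s_r /=; first by rewrite big1_eq.
rewrite big_split /= IHs => [|y y_s]; last by apply: s_r; rewrite inE y_s orbT.
rewrite -add1n; congr (_ + _).
have := count_uniq_mem x uniq_r; rewrite s_r ?mem_head // -sum1_count big_mkcond.
by apply: etrans; apply: eq_bigr => v _ /=; rewrite eq_sym; case: (v == x).
Qed.

(** Slots for the next vertex, sorted by their number [c v] of children: hanging it on a leaf keeps
    [l], on a vertex with one child raises it. *)
Lemma count_lt2 (r : seq nat) (c : nat -> nat) (P : pred nat) l :
  count (fun v => (c v < 2) && P (l + (c v != 0))) r =
    count (fun v => c v == 0) r * P l + count (fun v => c v == 1) r * P l.+1.
Proof.
elim: r => //= v r ->; rewrite !mulnDl.
by case: (c v) => [|[|k]] /=; rewrite ?addn0 ?addn1; lia.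
Qed.

(** Each vertex contributes 2 on both sides: its children plus its free places. *)
Lemma sum_le2 (r : seq nat) (c : nat -> nat) :
    (forall v, c v <= 2) ->
  (count (fun v => c v == 0) r).*2 + count (fun v => c v == 1) r
    + \sum_(v <- r) c v = (size r).*2.
Proof.
move=> c2; elim: r => [|v r IHr]; first by rewrite big_nil.
rewrite big_cons /=; have := c2 v; case: (c v) => [|[|[|k]]] //=; lia.
Qed.

Lemma parent_seqs_stats n :
  perm_eq [seq leaf_count n.+1 s | s <- parent_seqs n.+1]
    (flatten [seq extension_stats n l | l <- [seq leaf_count n s | s <- parent_seqs n]]).
Proof.
rewrite parent_seqsS; apply: perm_map_flatten => s /parent_seqsP[sz_s s_le s_2].
have s_n : all (fun a => a <= n) s.
  by apply/(all_nthP 0) => i; rewrite sz_s => i_n; apply: leq_trans (s_le i i_n) _; lia.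
apply/seq.permP => P; rewrite -map_comp count_map count_filter.
rewrite /extension_stats count_cat !count_nseq.
rewrite (eq_in_count
  (a2 := fun v => (count_mem v s < 2) && P (leaf_count n s + (count_mem v s != 0)))).
  rewrite count_lt2.
  have c0 : count (fun v => count_mem v s == 0) (iota 0 n.+1) = leaf_count n s.
    by apply: eq_count => v; rewrite -[v \in s]has_pred1 has_count -eqn0Ngt.
  rewrite c0; have := sum_le2 (iota 0 n.+1) s_2.
  rewrite sum_count_mem ?iota_uniq ?size_iota ?sz_s //; last first.
    by move=> v /(allP s_n); rewrite (mem_iota 0 n.+1).
  rewrite c0; set c1 := count _ _; set l := leaf_count _ _ => El.
  (* The n+1 vertices have n children in all, so 2 l + c1 + n = 2 (n+1). *)
  have -> : n.+2 - l.*2 = c1 by lia.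
  by rewrite mulnC [c1 * _]mulnC.
move=> v; rewrite (mem_iota 0 n.+1) /= ltnS => v_n.
by rewrite andbC leaf_count_rcons // -[v \in s]has_pred1 has_count lt0n.
Qed.

Lemma eq_set2 (T : finType) (a b c d : T) :
  [set a; b] = [set c; d] -> (a = c /\ b = d) \/ (a = d /\ b = c).
Proof.
move=> abcd; have /setP/(_ a) := abcd; have /setP/(_ b) := abcd.
have /setP/(_ c) := abcd; have /setP/(_ d) := abcd.
rewrite !inE !eqxx ?orbT (eq_sym d) (eq_sym c) (eq_sym d b) (eq_sym c b).
by do 4!case: eqP => ?; subst; auto.
Qed.

(** * Increasing trees as graphs *)

Section Graphs.
Variable n : nat.
Notation V := 'I_n.+1.
Implicit Types (E : {set {set V}}) (x y : V) (f : {ffun 'I_n -> V}).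

Lemma adj_sym E x y : adj E x y = adj E y x.
Proof. by rewrite /adj setUC. Qed.

Lemma size_uniq_vertices (s : seq V) : uniq s -> size s <= n.+1.
Proof. by move=> /card_uniqP<-; rewrite -[X in _ <= X]card_ord max_card. Qed.

Lemma root_path_size E p : root_path E p -> size p <= n.
Proof. by case/andP=> _ /size_uniq_vertices. Qed.

Lemma root_path_sorted E p :
  increasing E -> root_path E p -> path ltn (val (ord0 : V)) [seq val x | x <- p].
Proof.
move=> /forallP incE Ep; have /implyP := incE (Bseq (root_path_size Ep)).
exact.
Qed.

Lemma path_ltn_le_last a (s : seq nat) :
  path ltn a s -> all (fun b => b <= last a s) (a :: s).
Proof.
elim: s a => [|b s IHs] a /=; first by rewrite leqnn.
case/andP=> ab /IHs /= /andP[b_l ->]; rewrite b_l !andbT.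
exact: leq_trans (ltnW ab) b_l.
Qed.

Lemma root_path_le_last E p :
  increasing E -> root_path E p -> all (fun x : V => x <= last ord0 p) (ord0 :: p).
Proof.
move=> incE Ep; have := path_ltn_le_last (root_path_sorted incE Ep).
by rewrite last_map -(all_map (fun x : V => val x) (fun b => b <= _) (ord0 :: p)).
Qed.

Lemma connected_root_path E y :
  connected E -> exists2 p, root_path E p & last ord0 p = y.
Proof.
move=> /forallP/(_ ord0)/forallP/(_ y)/connectP[p Ep ->].
by case/shortenP: Ep => q Eq uniq_q _; exists q => //; apply/andP.
Qed.

Lemma root_path_rcons E q y :
    increasing E -> root_path E (rcons q y) ->
  [/\ root_path E q, last ord0 q < y & adj E (last ord0 q) y].
Proof.
move=> incE Eqy; have := root_path_sorted incE Eqy.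
rewrite map_rcons rcons_path last_map => /andP[_ ltqy].
move: Eqy; rewrite /root_path rcons_path -rcons_cons rcons_uniq.
by case/andP=> /andP[Eq adj_qy] /andP[_ uniq_q]; split=> //; apply/andP.
Qed.

(** The end of a root path is its largest vertex, so a root path to [x] can be prolonged by any
    larger neighbour without repetition. *)
Lemma childE E x y : connected E -> increasing E -> child E x y = (x < y) && adj E x y.
Proof.
move=> connE incE; apply/existsP/andP => [[p /existsP[q]]|[ltxy Exy]].
  case/and3P=> Ep /eqP def_p /eqP <-; move: Ep; rewrite def_p.
  by case/(root_path_rcons incE).
have [q Eq def_x] := connected_root_path x connE.
have Eqy : root_path E (rcons q y).
  have /andP[path_q uniq_q] := Eq.
  rewrite /root_path rcons_path path_q def_x Exy -rcons_cons rcons_uniq uniq_q !andbT !andTb.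
  apply/negP => /(allP (root_path_le_last incE Eq)).
  by rewrite def_x leqNgt ltxy.
exists (Bseq (root_path_size Eqy)); apply/existsP.
exists (Bseq (root_path_size Eq)); rewrite Eqy /= eqxx; exact/eqP.
Qed.

Lemma parent_exists E y :
    connected E -> increasing E -> y != ord0 ->
  exists2 x : V, x < y & adj E x y.
Proof.
move=> connE incE; have [p Ep <-] := connected_root_path y connE.
case/lastP: p Ep => [|q z]; first by rewrite eqxx.
by case/(root_path_rcons incE) => _; rewrite last_rcons; exists (last ord0 q).
Qed.

(* Were there two parents, they would be joined by a path through vertices     *)
(* smaller than [y], closing a cycle with [y].                                 *)
Lemma parent_unique E x x' y :
    tree E -> increasing E -> x < y -> adj E x y -> x' < y -> adj E x' y ->
  x = x'.
Proof.
case/and3P=> _ connE /forallP acycE incE ltxy Exy ltx'y Ex'y.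
pose e (u v : V) := [&& u < y, v < y & adj E u v].
have e_sym : symmetric e by move=> u v; rewrite /e adj_sym andbCA.
have e0 (z : V) : z < y -> connect e ord0 z.
  move=> ltzy; have [p Ep def_z] := connected_root_path z connE.
  have p_y : all (fun u : V => u < y) (ord0 :: p).
    apply/allP=> u /(allP (root_path_le_last incE Ep)).
    by rewrite def_z => /leq_ltn_trans; apply.
  apply/connectP; exists p => //; case/andP: Ep => path_p _.
  apply: sub_in_path p_y path_p => u v u_y v_y Euv.
  by apply/and3P.
have : connect e x x'.
  by apply: connect_trans (e0 _ ltx'y); rewrite (sym_connect_sym e_sym) e0.
case/connectP=> p0 /shortenP[p path_p uniq_p _] def_x'.
have p_y : all (fun u : V => u < y) (x :: p).
  rewrite /= ltxy; apply/allP=> u; elim: (p) (x) path_p => //= v q IHq w.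
  case/andP=> /and3P[_ v_y _] path_q; rewrite inE => /predU1P[->//|].
  exact: IHq path_q.
have {}path_p : path (adj E) x p.
  by apply: sub_path path_p => u v /and3P[].
(* An empty path gives x = x'; otherwise y, x, z start a cycle of length at least 3. *)
case: p => [|z p] // in path_p uniq_p p_y def_x' *.
have uniq_c : uniq [:: y, x, z & p].
  rewrite cons_uniq uniq_p andbT; apply/negP => /(allP p_y).
  by rewrite ltnn.
have cyc_c : path.cycle (adj E) [:: y, x, z & p].
  change (adj E y x && path (adj E) x (rcons (z :: p) y)).
  by rewrite rcons_path path_p -def_x' adj_sym Exy.
by have := acycE (Bseq (size_uniq_vertices uniq_c)); rewrite /ucycleb cyc_c uniq_c.
Qed.

(** * Graphs of parent functions *)

(** [f i] is the parent of [lift ord0 i], that is, of vertex i+1, so the bound says that parents are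
    smaller than children. *)
Definition parent_incr f := [forall i, f i <= i].

Definition graph_of f : {set {set V}} := [set [set f i; lift ord0 i] | i : 'I_n].

Lemma parent_ltP f i : parent_incr f -> f i < lift ord0 i.
Proof. by move/forallP/(_ i); rewrite lift0 ltnS. Qed.

Lemma adj_graph_ofP f x y :
    parent_incr f -> x < y ->
  reflect (exists2 i, y = lift ord0 i & x = f i) (adj (graph_of f) x y).
Proof.
move=> incf ltxy; apply: (iffP imsetP) => [[i _]|[i -> ->]]; last by exists i.
case/eq_set2=> -[def_x def_y]; first by exists i.
by have := parent_ltP i incf; rewrite -def_x -def_y ltnNge ltnW.
Qed.

Lemma adj_graph_of_neq f x y : parent_incr f -> adj (graph_of f) x y -> x != y.
Proof.
move=> incf /imsetP[i _ xyi]; apply: contraTneq (parent_ltP i incf) => exy.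
case: (eq_set2 xyi) => -[<- <-]; by rewrite exy ltnn.
Qed.

Lemma lower_neighbour_unique f x x' y :
    parent_incr f -> x < y -> adj (graph_of f) x y -> x' < y ->
  adj (graph_of f) x' y -> x = x'.
Proof.
move=> incf ltxy /(adj_graph_ofP incf ltxy)[i -> ->] ltx'y.
by case/(adj_graph_ofP incf ltx'y) => j /lift_inj-> ->.
Qed.

Lemma graph_of_simple f : parent_incr f -> simple_graph (graph_of f).
Proof.
move=> incf; apply/forall_inP => _ /imsetP[i _ ->].
by have := parent_ltP i incf; rewrite cards2; case: (f i =P _) => // ->; rewrite ltnn.
Qed.

Lemma graph_of_connected f : parent_incr f -> connected (graph_of f).
Proof.
move=> incf; have e_sym : symmetric (adj (graph_of f)) by move=> x y; apply: adj_sym.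
have c0 y : connect (adj (graph_of f)) ord0 y.
  have [k] := ubnP (y : nat); elim: k y => // k IHk y; rewrite ltnS => y_k.
  case: (unliftP ord0 y) => [i|] def_y; last by rewrite def_y.
  have ltfy : f i < y by rewrite def_y parent_ltP.
  apply: connect_trans (IHk (f i) (leq_trans ltfy y_k)) (connect1 _).
  by apply/adj_graph_ofP => //; exists i.
apply/forallP=> x; apply/forallP=> y.
by apply: connect_trans (c0 y); rewrite (sym_connect_sym e_sym).
Qed.

(* The largest vertex of a cycle would have two distinct parents. *)
Lemma graph_of_acyclic f : parent_incr f -> acyclic (graph_of f).
Proof.
move=> incf; apply/forallP=> -[c /= _]; apply/implyP=> /andP[cyc_c uniq_c].
case: c => [//|c0 c1] in cyc_c uniq_c *; set c := c0 :: c1 in cyc_c uniq_c *.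
case: (@arg_maxnP _ c0 (mem c) val (mem_head _ _)) => y y_c y_max.
(* The cycle is rotated to start at its maximum y, whose neighbours on it are the second and the
   last vertex. *)
case: (rot_to y_c) => i c' def_c.
have {}y_max z : z \in c' -> z < y.
  move=> z_c'; have z_c : z \in c by rewrite -(mem_rot i) def_c inE z_c' orbT.
  have le_zy : z <= y := y_max z z_c.
  rewrite ltn_neqAle le_zy andbT val_eqE.
  have : uniq (y :: c') by rewrite -def_c rot_uniq.
  by case/andP=> y_c' _; apply: contraNneq y_c' => <-.
rewrite -(size_rot i) def_c ltnNge; apply/negP => sz_c'.
move: uniq_c cyc_c; rewrite -(rot_uniq i) -(rot_cycle i) def_c.
case: c' => [|z [|t p]] // in y_max {def_c} sz_c' *.
rewrite [uniq _]/= => /and4P[_ z_tp _ _].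
rewrite /path.cycle rcons_path => /andP[/= /and3P[Eyz _ _] Ely].
have ltz : z < y by apply: y_max; rewrite inE eqxx.
have ltl : last t p < y by apply: y_max; rewrite !inE -in_cons mem_last orbT.
rewrite adj_sym in Eyz.
move: z_tp; rewrite (lower_neighbour_unique incf ltz Eyz ltl Ely).
by rewrite mem_last.
Qed.

(** A simple path that cannot step down from [x] must go up to some y; the only lower neighbour of y
    is then [x], already used, so the path keeps going up. At the root the condition is vacuous. *)
Lemma graph_of_path_increasing f x p :
    parent_incr f -> {in p, forall z : V, z < x -> ~~ adj (graph_of f) z x} ->
    path (adj (graph_of f)) x p -> uniq (x :: p) ->
  path ltn (val x) [seq val z | z <- p].
Proof.
move=> incf; elim: p x => //= y p IHp x no_parent /andP[Exy path_p].
case/and3P=> x_yp y_p uniq_p.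
have ltxy : x < y.
  rewrite ltn_neqAle val_eqE (adj_graph_of_neq incf Exy) leqNgt.
  by apply/negP => /(no_parent y (mem_head _ _)); rewrite adj_sym Exy.
rewrite ltxy IHp ?y_p // => z z_p ltzy; apply/negP => Ezy.
have def_x := lower_neighbour_unique incf ltxy Exy ltzy Ezy.
by rewrite def_x inE z_p orbT in x_yp.
Qed.

Lemma graph_of_increasing f : parent_incr f -> increasing (graph_of f).
Proof.
move=> incf; apply/forallP=> -[p /= _]; apply/implyP=> /andP[path_p uniq_p].
exact: (@graph_of_path_increasing f ord0 p).
Qed.

Lemma graph_of_tree f : parent_incr f -> tree (graph_of f).
Proof.
move=> incf; apply/and3P.
by rewrite graph_of_simple ?graph_of_connected ?graph_of_acyclic.
Qed.

Lemma graph_of_inj : {in [pred f | parent_incr f] &, injective graph_of}.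
Proof.
move=> f g incf incg fg; apply/ffunP=> i.
have ltfi := parent_ltP i incf.
have : adj (graph_of f) (f i) (lift ord0 i) by apply/adj_graph_ofP => //; exists i.
by rewrite fg => /(adj_graph_ofP incg ltfi)[j /lift_inj<-].
Qed.

(** Take for [f] a choice of smaller neighbour of each nonzero vertex. Every edge joins its larger
    end to a smaller neighbour, which by [parent_unique] is the chosen one. *)
Lemma increasing_tree_graph_of E :
  tree E -> increasing E -> exists2 f, parent_incr f & E = graph_of f.
Proof.
move=> treeE incE; have /and3P[simpE connE _] := treeE.
have parentP i : exists x : V, (x < lift ord0 i) && adj E x (lift ord0 i).
  have [//|x ltx Ex] := @parent_exists E (lift ord0 i) connE incE.
  by exists x; rewrite ltx.
pose f := [ffun i => xchoose (parentP i)].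
have fP i : f i < lift ord0 i /\ adj E (f i) (lift ord0 i).
  by rewrite ffunE; apply/andP/(xchooseP (parentP i)).
exists f; first by apply/forallP=> i; have [] := fP i; rewrite lift0.
apply/setP=> e; apply/idP/imsetP => [Ee|[i _ ->]]; last by have [] := fP i.
have /cards2P[x [y [neq_xy def_e]]] := forall_inP simpE e Ee.
wlog ltxy : x y neq_xy def_e / x < y.
  move=> IH; case: (ltngtP x y) => [|ltyx|/val_inj exy]; first exact: IH.
    by apply: (IH y x); rewrite // 1?eq_sym // setUC.
  by rewrite exy eqxx in neq_xy.
case: (unliftP ord0 y) => [i|] def_y; last by rewrite def_y in ltxy.
exists i => //; rewrite def_e -def_y; congr [set _; _].
have [ltf Ef] := fP i; rewrite -def_y in ltf Ef.
apply: (parent_unique treeE incE ltxy _ ltf Ef).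
by rewrite /adj -def_e.
Qed.

Lemma children_graph_of f x :
  parent_incr f -> children (graph_of f) x = lift ord0 @: [set i | f i == x].
Proof.
move=> incf; apply/setP=> y.
rewrite inE childE ?graph_of_connected ?graph_of_increasing //.
apply/andP/imsetP => [[ltxy /(adj_graph_ofP incf ltxy)[i -> ->]]|[i]].
  by exists i; rewrite ?inE.
rewrite inE => /eqP def_x ->; have ltx := parent_ltP i incf.
by rewrite -def_x; split=> //; apply/adj_graph_ofP => //; exists i.
Qed.

Definition parent_seq f : seq nat := [seq val (f i) | i <- enum 'I_n].

Lemma count_parent_seq f x : count_mem (val x) (parent_seq f) = #|[set i | f i == x]|.
Proof.
rewrite count_map cardsE cardE [in RHS]/enum_mem size_filter -enumT.
by apply: eq_count => i.
Qed.

Definition parent_funs : {set {ffun 'I_n -> V}} :=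
  [set f | parent_incr f && [forall x, #|[set i | f i == x]| <= 2]].

Lemma increasing_12_treesE : increasing_12_trees n = graph_of @: parent_funs.
Proof.
apply/setP=> E; rewrite inE; apply/and3P/imsetP => [[treeE incE]|[f]].
  have [f incf ->] := increasing_tree_graph_of treeE incE.
  move=> /forallP ch2; exists f => //; rewrite inE incf; apply/forallP=> x.
  by have := ch2 x; rewrite children_graph_of // card_imset //; apply: lift_inj.
rewrite inE => /andP[incf /forallP f2] ->; split.
- exact: graph_of_tree.
- exact: graph_of_increasing.
apply/forallP=> x; rewrite children_graph_of // card_imset //; exact: lift_inj.
Qed.

Lemma card_leaves_graph_of f :
  parent_incr f -> #|leaves (graph_of f)| = leaf_count n (parent_seq f).
Proof.
move=> incf; rewrite /leaf_count -val_enum_ord count_map cardsE cardE [in LHS]/enum_mem size_filter.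
rewrite -enumT; apply: eq_count => x.
transitivity (children (graph_of f) x == set0); first by [].
rewrite children_graph_of //.
rewrite -cards_eq0 card_imset; last exact: lift_inj.
rewrite -count_parent_seq [RHS]/=.
by rewrite -[_ \in parent_seq f]has_pred1 has_count -eqn0Ngt.
Qed.

Lemma parent_seq_inj : injective parent_seq.
Proof.
move=> f g /eq_in_map fg; apply/ffunP => i; apply/val_inj/fg.
exact: mem_enum.
Qed.

Lemma size_parent_seq f : size (parent_seq f) = n.
Proof. by rewrite size_map size_enum_ord. Qed.

Lemma nth_parent_seq f (i : 'I_n) : nth 0 (parent_seq f) i = f i.
Proof. by rewrite (nth_map i) ?size_enum_ord // nth_ord_enum. Qed.

Lemma perm_parent_funs : perm_eq [seq parent_seq f | f <- enum parent_funs] (parent_seqs n).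
Proof.
apply: uniq_perm (parent_seqs_uniq n) _.
  by rewrite map_inj_uniq ?enum_uniq //; apply: parent_seq_inj.
move=> s; apply/mapP/parent_seqsP => [[f]|[sz_s s_le s_2]].
  rewrite mem_enum inE => /andP[/forallP incf /forallP f2] ->.
  split=> [|i i_n|v]; first exact: size_parent_seq.
    by rewrite (nth_parent_seq f (Ordinal i_n)); apply: incf.
  have [v_n|n_v] := ltnP v n.+1.
    by have := f2 (Ordinal v_n); rewrite -count_parent_seq.
  rewrite leqNgt; apply/negP => /ltnW/ltnW; rewrite -has_count has_pred1.
  by case/mapP=> i _ def_v; have := ltn_ord (f i); rewrite -def_v ltnNge n_v.
(* [inord] loses nothing here, as entry [i] is at most [i] and hence at most n. *)
pose f : {ffun 'I_n -> V} := [ffun i : 'I_n => inord (nth 0 s i)].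
have fE i : f i = nth 0 s i :> nat.
  rewrite ffunE inordK // ltnS; apply: leq_trans (s_le i _) (ltnW _) => //.
have def_s : s = parent_seq f.
  apply: (@eq_from_nth _ 0); rewrite ?size_parent_seq // sz_s => i i_n.
  by rewrite (nth_parent_seq f (Ordinal i_n)) fE.
exists f => //; rewrite mem_enum inE; apply/andP; split.
  by apply/forallP=> i; rewrite fE s_le.
by apply/forallP=> x; rewrite -count_parent_seq -def_s.
Qed.

Lemma perm_tree_leaves :
  perm_eq [seq #|leaves T| | T <- enum (increasing_12_trees n)]
          [seq leaf_count n s | s <- parent_seqs n].
Proof.
apply: perm_trans (perm_map _ perm_parent_funs); rewrite -map_comp.
have incF f : f \in enum parent_funs -> parent_incr f.
  by rewrite mem_enum inE => /andP[].
have -> : [seq (leaf_count n \o parent_seq) f | f <- enum parent_funs]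
        = [seq #|leaves T| | T <- map graph_of (enum parent_funs)].
  by rewrite -map_comp; apply/eq_in_map => f /incF incf; rewrite /= card_leaves_graph_of.
apply: perm_map; apply: uniq_perm; first exact: enum_uniq.
  rewrite map_inj_in_uniq ?enum_uniq // => f g /incF incf /incF incg.
  exact: graph_of_inj.
move=> E; rewrite mem_enum increasing_12_treesE.
by apply/imsetP/mapP => -[f f_F ->]; exists f; rewrite ?mem_enum // -mem_enum.
Qed.

End Graphs.

(** * Matching the two families *)

(** For n = 0 both multisets are {1}: the single vertex is a leaf and the empty word has no descent.
    Both then evolve by the same [extension_stats]. *)
Lemma perm_leaves_descents n :
  perm_eq [seq leaf_count n s | s <- parent_seqs n]
          [seq (des w).+1 | w <- simsun_words n].
Proof.
elim: n => [|n IHn] //.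
apply: perm_trans (parent_seqs_stats n) _; rewrite perm_sym.
apply: perm_trans (simsun_words_stats n) _; rewrite perm_sym.
exact: perm_flatten_map.
Qed.

Theorem theorem2p1 (n : nat) (n_ge1 : 1 <= n) :
  exists phi : {T : {set {set 'I_n.+1}} | T \in increasing_12_trees n} ->
               {s : 'S_n | s \in simsun_perms n},
    bijective phi /\
    forall (T : {T : {set {set 'I_n.+1}} | T \in increasing_12_trees n})
           (k : nat),
      #|leaves (val T)| = k.+1 -> #|descents (word (val (phi T)))| = k.
Proof.
have enum_sig (T : finType) (A : {set T}) :
    perm_eq (map val (enum {: {x : T | x \in A}})) (enum A).
  apply: uniq_perm (enum_uniq _) _.
    by rewrite map_inj_uniq ?enum_uniq //; apply: val_inj.
  move=> x; rewrite mem_enum; apply/mapP/idP => [[[y Ay] _ ->] //|Ax].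
  by exists (exist _ x Ax); rewrite ?mem_enum.
have [phi [phi_bij phiE]] :
    exists phi : {T : {set {set 'I_n.+1}} | T \in increasing_12_trees n} ->
                 {s : 'S_n | s \in simsun_perms n},
    bijective phi /\ forall T, (des (word (val (phi T)))).+1 = #|leaves (val T)|.
  apply: (@perm_stat_bij _ _ (fun T => #|leaves (val T)|) (fun s => (des (word (val s))).+1)).
  rewrite (map_comp (fun T => #|leaves T|) val).
  rewrite (map_comp (fun s => (des (word s)).+1) val).
  apply: perm_trans (perm_map _ (enum_sig _ _)) _.
  apply: perm_trans (perm_tree_leaves n) _.
  apply: perm_trans (perm_leaves_descents n) _.
  rewrite perm_sym; apply: perm_trans (perm_map _ (enum_sig _ _)) _.
  by rewrite (map_comp (fun w => (des w).+1) (@word n)); apply/perm_map/perm_simsun_perms.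
by exists phi; split=> // T k; rewrite -phiE card_descents => -[].
Qed.
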